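(* Let $\ell\ge 0$ be an integer and let $(A_{i,j})$ and $(B_{i,j})$ ($0\le i\le \ell$, $j\in\mathbb{Z}_{\ge 0}$) be families of complex numbers. For $0\le i\le\ell$ put $\phi_i(x;0)=1$ and $\phi_i(x;n)=\prod_{k=0}^{n-1}(A_{i,k}+xB_{i,k})$ for $n\ge 1$, and put $$\Phi(x;n)=\prod_{i=0}^{\ell}\phi_i\!\left(x;\left[\tfrac{i+n}{\ell+1}\right]\right)\qquad(n\ge 0).$$ For $k\ge 0$, writing $k=(\ell+1)p+q$ with $0\le q\le \ell$, put $\lambda(k)=A_{\ell-q,\,p}+k\,B_{\ell-q,\,p}$. Assume that $\Phi(x;n)\neq 0$ for all nonnegative integers $x,n$. Then for any two sequences $(F(n))_{n\ge0}$ and $(G(n))_{n\ge 0}$ of complex numbers, the system of equations $$F(n)=\sum_{k=0}^{n}(-1)^k\binom{n}{k}\,\Phi(k;n)\,G(k)\qquad (n=0,1,2,\dots)$$ is equivalent to the system of equations $$G(n)=\sum_{k=0}^{n}(-1)^k\binom{n}{k}\,\frac{\lambda(k)}{\Phi(n;k+1)}\,F(k)\qquad (n=0,1,2,\dots).$$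
   Context: $[x]$ denotes the integer part (floor) of the real number $x$. *)

(* Defs.v *)
From mathcomp Require Import all_boot all_order all_algebra.
From mathcomp Require Import reals.
From mathcomp Require Import complex.

Set Implicit Arguments.
Unset Strict Implicit.
Unset Printing Implicit Defensive.

Import GRing.Theory.

Local Open Scope ring_scope.

Section Definitions.

Variables (C : comPzRingType) (l : nat).
Variables (A B : 'I_l.+1 -> nat -> C).

Definition phi (i : 'I_l.+1) (x : C) (n : nat) : C :=
  \prod_(0 <= k < n) (A i k + x * B i k).

(* Integer parts are rendered by the Euclidean quotient %/ on nat. *)
Definition Phi (x : C) (n : nat) : C :=
  \prod_(i < l.+1) phi i x ((i + n) %/ l.+1)%N.

(* k = (l + 1) p + q with 0 <= q <= l; [inord] is exact here since
   l - q <= l. *)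
Definition lambda (k : nat) : C :=
  let p := (k %/ l.+1)%N in
  let q := (k %% l.+1)%N in
  A (inord (l - q)) p + k%:R * B (inord (l - q)) p.

End Definitions.

(* Main.v *)
Require Import Defs.
From mathcomp Require Import all_boot all_order all_algebra.
From mathcomp Require Import reals.
From mathcomp Require Import complex.
From mathcomp Require Import ring zify.

Set Implicit Arguments.
Unset Strict Implicit.
Unset Printing Implicit Defensive.

Import GRing.Theory.

Local Open Scope ring_scope.

(** The product [Phi] is a disguise of an ordinary product.  When [n] is
    increased by one, exactly one of the integer parts [(i + n) / (l + 1)],
    [0 <= i <= l], increases, namely the one for which [l + 1] divides
    [i + n + 1]; hence [Phi x n.+1 = Phi x n * (a n + x * b n)] where [a] and
    [b] list the entries of [A] and [B] in the order in which they are met,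
    and [lambda k] is the factor [a k + x * b k] taken at [x = k].  The theorem
    is therefore the Gould-Hsu inversion for the products
    [psi x n = \prod_(k < n) (a k + x * b k)].

    The two systems are governed by lower triangular matrices [M] and [N].
    The entry [(n, m)] of [N M], for [m < n], is the sum over [k] of
    [(-1)^(k + m) C(n, k) C(k, m) (a k + k * b k) psi m k / psi n k.+1],
    and the identity
    [(n - m) (a k + k * b k) = (n - k) (a k + m * b k) + (k - m) (a k + n * b k)]
    makes it telescope to zero ([gould_hsu_telescope],
    [gould_hsu_orthogonality]); the diagonal entries are clearly [1].  A left
    inverse of a finite square matrix over a commutative ring is also a right
    inverse, so [M] and [N] are mutually inverse and the systems are equivalent
    ([triangular_inversion]). *)

Section TriangularInversion.

Variables (K : comNzRingType) (M N : nat -> nat -> K).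
Hypothesis M_triangular : forall n k, (n < k)%N -> M n k = 0.
Hypothesis N_triangular : forall n k, (n < k)%N -> N n k = 0.
Hypothesis left_inverse : forall n m,
  \sum_(0 <= k < n.+1) N n k * M k m = (n == m)%:R.

Let truncation (T : nat -> nat -> K) d : 'M[K]_d := \matrix_(i, j) T i j.

Lemma triangular_sum_widen (T : nat -> nat -> K) (H : nat -> K) d n :
  (forall k, (n < k)%N -> T n k = 0) -> (n < d)%N ->
  \sum_(0 <= k < n.+1) T n k * H k = \sum_(k < d) T n k * H k.
Proof.
move=> T0 lt_nd; rewrite -(big_mkord xpredT (fun k => T n k * H k)).
rewrite [RHS](@big_cat_nat _ _ _ n.+1) //= [X in _ + X]big_nat_cond.
rewrite [X in _ + X]big1 ?addr0 // => k /andP[/andP[lt_nk _] _].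
by rewrite T0 ?mul0r.
Qed.

Lemma truncation_left_inverse d : truncation N d *m truncation M d = 1%:M.
Proof.
apply/matrixP => i j; rewrite !mxE.
under eq_bigr do rewrite !mxE.
by rewrite -(triangular_sum_widen (M^~ j) (@N_triangular i)) ?left_inverse.
Qed.

Lemma triangular_system_truncation (T : nat -> nat -> K) (H J : nat -> K) :
  (forall n k, (n < k)%N -> T n k = 0) ->
  (forall n, J n = \sum_(0 <= k < n.+1) T n k * H k) <->
  (forall d, \col_(i < d) J i = truncation T d *m \col_(i < d) H i).
Proof.
move=> T0; split=> [HJ d | HJ n].
  apply/matrixP => i j; rewrite !mxE HJ (@triangular_sum_widen _ _ d) //; last exact: T0.
  by apply: eq_bigr => k _; rewrite !mxE.
have /matrixP/(_ ord_max ord0) := HJ n.+1; rewrite !mxE /= => ->.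
rewrite (@triangular_sum_widen _ _ n.+1) //; last exact: T0.
by apply: eq_bigr => k _; rewrite !mxE.
Qed.

(** Only the identity [N M = 1] is assumed; the reverse product is obtained on
    the finite truncations, where one-sided inverses are two-sided. *)
Lemma triangular_inversion (F G : nat -> K) :
  (forall n, F n = \sum_(0 <= k < n.+1) M n k * G k) <->
  (forall n, G n = \sum_(0 <= k < n.+1) N n k * F k).
Proof.
rewrite !triangular_system_truncation //.
have NM := truncation_left_inverse.
split=> eqs d; rewrite eqs mulmxA; first by rewrite NM mul1mx.
by rewrite (mulmx1C (NM d)) mul1mx.
Qed.

End TriangularInversion.

Definition psi (K : comPzRingType) (a b : nat -> K) (x : K) (n : nat) : K :=
  \prod_(0 <= k < n) (a k + x * b k).

Lemma psiS (K : comPzRingType) (a b : nat -> K) x n :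
  psi a b x n.+1 = psi a b x n * (a n + x * b n).
Proof. by rewrite /psi big_nat_recr. Qed.

Section GouldHsu.

Variables (K : numFieldType) (a b : nat -> K).

Local Notation psi := (psi a b).

Hypothesis psi_neq0 : forall x n : nat, psi x%:R n != 0.

Lemma psi_factor_neq0 x n : a n + x%:R * b n != 0.
Proof. by have := psi_neq0 x n.+1; rewrite psiS mulf_eq0 negb_or => /andP[]. Qed.

(** What allows the two halves of the summand to be matched by shifting [k]. *)
Lemma bin_mul_bin_step n k m :
  ((n - k) * ('C(n, k) * 'C(k, m)) = (k.+1 - m) * ('C(n, k.+1) * 'C(k.+1, m)))%N.
Proof.
by rewrite mulnA -mul_bin_left [RHS]mulnCA -mul_bin_down /= mulnCA mulnA.
Qed.

Definition gould_hsu n k : K := (-1) ^+ k * 'C(n, k)%:R * psi k%:R n.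

Definition gould_hsu_inverse n k : K :=
  (-1) ^+ k * 'C(n, k)%:R * ((a k + k%:R * b k) / psi n%:R k.+1).

(** An antidifference in [k] of [n - m] times the summand of the entry [(n, m)]
    of the matrix product; it vanishes at [k = 0] and at [k = n + 1]. *)
Definition gould_hsu_primitive n m k : K :=
  (-1) ^+ (k + m).+1 * ((k - m) * ('C(n, k) * 'C(k, m)))%:R
  * (psi m%:R k / psi n%:R k).

Lemma gould_hsu_telescope n m k :
  (n%:R - m%:R) * (gould_hsu_inverse n k * gould_hsu k m)
  = gould_hsu_primitive n m k.+1 - gould_hsu_primitive n m k.
Proof.
rewrite /gould_hsu_primitive /gould_hsu /gould_hsu_inverse -bin_mul_bin_step.
rewrite addSn !exprS exprD.
(* Outside m <= k <= n all the terms vanish, so that the truncated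
   differences n - k and k - m may be read as differences in K. *)
have [le_kn | lt_nk] := leqP k n; last first.
  by rewrite bin_small // !(mul0n, muln0, mulr0, mul0r, subr0).
have [le_mk | lt_km] := leqP m k; last first.
  by rewrite (@bin_small k) // !(mul0n, muln0, mulr0, mul0r, subr0).
rewrite !psiS !natrM !natrB //.
by field; rewrite psi_neq0 psi_factor_neq0.
Qed.

Lemma gould_hsu_orthogonality n m :
  \sum_(0 <= k < n.+1) gould_hsu_inverse n k * gould_hsu k m = (n == m)%:R.
Proof.
have [<- | neq_nm] := eqVneq n m.
  (* Only k = n contributes, since 'C(k, n) = 0 for k < n. *)
  rewrite big_nat_recr //= big_nat_cond big1 ?add0r => [|k]; last first.
    by case/andP=> /andP[_ lt_kn] _; rewrite /gould_hsu bin_small // mulr0 mul0r mulr0.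
  rewrite /gould_hsu /gould_hsu_inverse binn !mulr1 psiS.
  rewrite mulrACA -exprD addnn -mul2n exprM sqrrN !expr1n mul1r.
  by field; rewrite psi_neq0 psi_factor_neq0.
have neq0 : n%:R - m%:R != 0 :> K by rewrite subr_eq0 Num.Theory.eqr_nat.
apply: (mulfI neq0); rewrite mulr0 mulr_sumr.
rewrite (@telescope_sumr_eq _ 0 n.+1 (gould_hsu_primitive n m)) // => [|k _]; last first.
  exact: gould_hsu_telescope.
by rewrite /gould_hsu_primitive bin_small // sub0n !(mul0n, muln0, mulr0, mul0r) subrr.
Qed.

Lemma gould_hsu_inversion (F G : nat -> K) :
  (forall n, F n = \sum_(0 <= k < n.+1) gould_hsu n k * G k) <->
  (forall n, G n = \sum_(0 <= k < n.+1) gould_hsu_inverse n k * F k).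
Proof.
apply: triangular_inversion gould_hsu_orthogonality F G => n k lt_nk.
- by rewrite /gould_hsu bin_small // mulr0 mul0r.
- by rewrite /gould_hsu_inverse bin_small // mulr0 mul0r.
Qed.

End GouldHsu.

Section Interlacing.

Variables (K : comPzRingType) (l : nat).

(** The entries of the [l + 1] rows of [T] in the order in which [Phi] uses
    them: column after column, each read from row [l] down to row [0]. *)
Definition interlace (T : 'I_l.+1 -> nat -> K) (k : nat) : K :=
  T (inord (l - k %% l.+1)) (k %/ l.+1)%N.

(** The number [i + n + 1] lies between [(n / (l + 1)) (l + 1) + 1] and
    [(n / (l + 1) + 2) (l + 1) - 1], so it has only one chance to be a multiple
    of [l + 1]. *)
Lemma dvdn_interlace (i n : nat) : (i <= l)%N ->
  (l.+1 %| (i + n).+1)%N = (i == l - n %% l.+1)%N.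
Proof.
move=> le_il; have lt_q := ltn_pmod n (ltn0Sn l).
rewrite {1}(divn_eq n l.+1) addnCA -addnS dvdn_addr ?dvdn_mull //.
move: (n %% _)%N lt_q => q lt_q; apply/idP/eqP => [/dvdnP[[|[|c]]] | ->].
- by [].
- by lia.
- by rewrite !mulSn; lia.
- by have -> : (l - q + q).+1 = l.+1 by lia.
Qed.

Variables A B : 'I_l.+1 -> nat -> K.

Local Notation a := (interlace A).
Local Notation b := (interlace B).

(** Of the [l + 1] products making up [Phi], only the one of row
    [r = l - n %% (l + 1)] gets a new factor, taken from column [n / (l + 1)]. *)
Lemma PhiS x n : Phi A B x n.+1 = Phi A B x n * (a n + x * b n).
Proof.
have lt_r : (l - n %% l.+1 < l.+1)%N by rewrite ltnS leq_subr.
set r : 'I_l.+1 := inord (l - n %% l.+1).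
have valr : r = (l - n %% l.+1)%N :> nat by rewrite inordK.
have stepE (i : 'I_l.+1) : ((i + n.+1) %/ l.+1 = (i == r) + (i + n) %/ l.+1)%N.
  by rewrite addnS divnS // dvdn_interlace -1?ltnS // -valr.
have quo_r : ((r + n) %/ l.+1 = n %/ l.+1)%N.
  have lt_q := ltn_pmod n (ltn0Sn l).
  rewrite valr [X in (_ + X)%N](divn_eq n l.+1) addnCA divnMDl //.
  by rewrite subnK ?(divn_small (ltnSn l)) ?addn0 // -ltnS.
rewrite /Phi (bigD1 r) //= [in RHS](bigD1 r) //= mulrAC; congr (_ * _).
  by rewrite stepE eqxx add1n /phi big_nat_recr //= quo_r.
by apply: eq_bigr => i /negPf neq_ir; rewrite stepE neq_ir add0n.
Qed.

Lemma Phi_psi x n : Phi A B x n = psi a b x n.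
Proof.
elim: n => [|n IHn]; last by rewrite PhiS psiS IHn.
rewrite /psi big_geq // /Phi big1 // => i _.
by rewrite addn0 divn_small // /phi big_geq.
Qed.

End Interlacing.

Theorem theorem2p1 (R : realType) (l : nat) (A B : 'I_l.+1 -> nat -> R[i])
  (hPhi : forall x n : nat, Phi A B x%:R n != 0)
  (F G : nat -> R[i]) :
  (forall n : nat,
     F n = \sum_(0 <= k < n.+1)
             (-1) ^+ k * 'C(n, k)%:R * Phi A B k%:R n * G k)
  <->
  (forall n : nat,
     G n = \sum_(0 <= k < n.+1)
             (-1) ^+ k * 'C(n, k)%:R
             * (lambda A B k / Phi A B n%:R k.+1) * F k).
Proof.
have psi_neq0 x n : psi (interlace A) (interlace B) x%:R n != 0.
  by rewrite -Phi_psi.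
have [FG GF] := gould_hsu_inversion psi_neq0 F G.
(* [lambda A B k] is, by definition, the factor of index k of psi at x = k. *)
split=> [HF n | HG n].
- rewrite FG => [|d]; last by rewrite HF; apply: eq_bigr => k _; rewrite Phi_psi.
  by apply: eq_bigr => k _; rewrite Phi_psi.
- rewrite GF => [|d]; last by rewrite HG; apply: eq_bigr => k _; rewrite Phi_psi.
  by apply: eq_bigr => k _; rewrite Phi_psi.
Qed.
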